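(* In Morpion Solitaire 5D, starting from the standard initial configuration, the number of moves in any play cannot exceed $132$.
   Context: Morpion Solitaire 5D is a one-player game on the integer lattice $\mathbb{Z}^2$. Initially there are 36 crosses, placed on the lattice points lying on the boundary of the 12-sided polygon (a ''Greek cross'') with consecutive vertices $(3,0),(6,0),(6,3),(9,3),(9,6),(6,6),(6,9),(3,9),(3,6),(0,6),(0,3),(3,3)$; each of its 12 edges contains exactly 4 lattice points. A move consists of: (1) placing a new cross on a lattice point that currently has no cross; (2) drawing a line, i.e. a segment covering exactly 5 consecutive lattice points in one of the four directions (horizontal, vertical, or one of the two diagonals), such that all 5 covered points carry crosses and one of them is the cross placed in step (1). In the 5D variant, a newly drawn line may not share any lattice point with a previously drawn line of the same direction. The game is a sequence of legal moves; its score is the number of moves. *)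

(* Defs.v *)
From mathcomp Require Import all_boot all_order all_algebra.

Set Implicit Arguments.
Unset Strict Implicit.
Unset Printing Implicit Defensive.

Import Order.TTheory GRing.Theory Num.Theory.
Local Open Scope ring_scope.

Definition point : Type := (int * int)%type.

(* p lies on the closed segment [a, b]: the vectors a - p and b - p are
   parallel and do not point the same way. *)
Definition on_segment (a b p : point) : bool :=
  let u := a - p in let v := b - p in
  (u.1 * v.2 - u.2 * v.1 == 0) && (u.1 * v.1 + u.2 * v.2 <= 0).

Definition greek_cross : seq point :=
  [:: (3, 0); (6, 0); (6, 3); (9, 3); (9, 6); (6, 6);
      (6, 9); (3, 9); (3, 6); (0, 6); (0, 3); (3, 3)].

Definition initial_cross (p : point) : bool :=
  has (fun e => on_segment e.1 e.2 p) (zip greek_cross (rot 1 greek_cross)).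

(* One vector per unoriented direction, so that every line has exactly one
   starting point and one direction vector. *)
Definition directions : seq point := [:: (1, 0); (0, 1); (1, 1); (1, -1)].

Record move : Type := Move {
  new_cross : point;
  line_start : point;
  line_dir : point }.

Definition line_points (m : move) : seq point :=
  [seq line_start m + line_dir m *+ i | i <- iota 0 5].

(* A history h : seq move lists the moves made so far, oldest first. *)
Definition has_cross (h : seq move) (p : point) : bool :=
  initial_cross p || (p \in [seq new_cross m | m <- h]).

Definition legal_move (h : seq move) (m : move) : bool :=
  [&& line_dir m \in directions,
      ~~ has_cross h (new_cross m),
      new_cross m \in line_points m,
      all (has_cross (rcons h m)) (line_points m)
    & all (fun m' => (line_dir m' == line_dir m) ==>
                     ~~ has (mem (line_points m')) (line_points m)) h].

Fixpoint legal_from (h ms : seq move) : bool :=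
  if ms is m :: ms' then legal_move h m && legal_from (rcons h m) ms' else true.

Definition legal_play (ms : seq move) : bool := legal_from [::] ms.

(* Main.v *)
(* The lines of one direction are pairwise disjoint and cover 5 crosses each,
   so after n moves there are at most (36 + n) / 5 of them.  After exactly 133
   moves this would be at most 33 lines in each of the four directions, hence
   at most 132 lines in total, although every move draws one. *)
Require Import Defs.
From mathcomp Require Import all_boot all_order all_algebra.
From mathcomp Require Import zify.

Set Implicit Arguments.
Unset Strict Implicit.
Unset Printing Implicit Defensive.

Import GRing.Theory.

(** [initial_cross] is a predicate on an infinite lattice; cutting it down to a finite box makes the
    crosses countable by computation. *)
Definition initial_crosses : seq point :=
  [seq p <- [seq (Posz i, Posz j) | i <- iota 0 10, j <- iota 0 10]
     | initial_cross p].

Lemma size_initial_crosses : size initial_crosses = 36.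
Proof. by vm_compute. Qed.

Lemma initial_cross_bounds (p : point) :
  initial_cross p -> (0 <= p.1 <= 9)%R /\ (0 <= p.2 <= 9)%R.
Proof.
case: p => x y; rewrite /initial_cross /on_segment /=.
(* One goal per edge. Each edge is parallel to an axis, so the vanishing determinant fixes one
   coordinate and the sign of the scalar product confines the other between the endpoints. *)
by do ![case/orP]; rewrite ?orbF // => /andP[/eqP]; nia.
Qed.

Lemma mem_initial_crosses (p : point) :
  initial_cross p -> p \in initial_crosses.
Proof.
move=> ip; rewrite mem_filter ip andTb.
have [] := initial_cross_bounds ip; case: p ip => x y _ hx hy.
rewrite /= in hx hy; apply/allpairsP; exists (`|x|%N, `|y|%N).
by rewrite !mem_iota /=; split; [lia | lia | congr pair; lia].
Qed.

Lemma legal_from_cat (h s1 s2 : seq move) :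
  legal_from h (s1 ++ s2) = legal_from h s1 && legal_from (h ++ s1) s2.
Proof.
elim: s1 h => [|m s1 IH] h /=; first by rewrite cats0.
by rewrite IH cat_rcons andbA.
Qed.

Lemma legal_play_rcons (ms : seq move) (m : move) :
  legal_play (rcons ms m) = legal_play ms && legal_move ms m.
Proof. by rewrite /legal_play -cats1 legal_from_cat /= andbT. Qed.

Lemma legal_play_take (n : nat) (ms : seq move) :
  legal_play ms -> legal_play (take n ms).
Proof.
by rewrite /legal_play -{1}(cat_take_drop n ms) legal_from_cat => /andP[].
Qed.

(** The starting point cancels, and distinct multiples of a nonzero integer vector differ. *)
Lemma uniq_line_points (m : move) :
  line_dir m \in directions -> uniq (line_points m).
Proof.
move=> dm; rewrite map_inj_in_uniq ?iota_uniq // => i j _ _ /addrI.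
by move: dm; rewrite !inE => /or4P[] /eqP->;
  rewrite !pairMnE => -[]; lia.
Qed.

(** Repetitions are kept, so that the length is five per line and [uniq] expresses disjointness of
    the lines. *)
Definition covered (d : point) (ms : seq move) : seq point :=
  flatten [seq line_points m | m <- ms & line_dir m == d].

Lemma size_covered (d : point) (ms : seq move) :
  size (covered d ms) = 5 * count (fun m => line_dir m == d) ms.
Proof.
rewrite /covered; elim: ms => //= m ms IH; case: ifP => _ //=.
by rewrite IH mulnDr.
Qed.

Lemma covered_rcons (d : point) (ms : seq move) (m : move) :
  covered d (rcons ms m) =
  covered d ms ++ (if line_dir m == d then line_points m else [::]).
Proof.
rewrite /covered filter_rcons; case: ifP => _; last by rewrite cats0.
by rewrite map_rcons flatten_rcons.
Qed.

Lemma has_cross_rcons (h : seq move) (m : move) (p : point) :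
  has_cross h p -> has_cross (rcons h m) p.
Proof.
rewrite /has_cross map_rcons mem_rcons inE.
by case/orP=> ->; rewrite ?orbT.
Qed.

(** Crosses are never removed: points that carry one when their line is drawn still do at the
    end. *)
Lemma covered_has_cross (d : point) (ms : seq move) :
  legal_play ms -> all (has_cross ms) (covered d ms).
Proof.
elim/last_ind: ms => // ms m IH; rewrite legal_play_rcons.
case/andP=> /IH cov /and5P[_ _ _ onm _].
rewrite covered_rcons all_cat; apply/andP; split; last by case: ifP.
by apply: sub_all cov => p; apply: has_cross_rcons.
Qed.

Lemma disjoint_covered (d : point) (ms : seq move) (s : seq point) :
  all (fun m => (line_dir m == d) ==> ~~ has (mem (line_points m)) s) ms ->
  ~~ has (mem (covered d ms)) s.
Proof.
rewrite /covered; elim: ms => [_|m ms IH] /=; first by rewrite has_pred0.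
case/andP=> disj_m /IH disj_ms; case: ifP disj_m => //= _ disj_m.
apply/hasPn => p ps.
change (p \notin line_points m ++ covered d ms).
rewrite mem_cat negb_or.
by apply/andP; split; [exact: (hasPn disj_m) | exact: (hasPn disj_ms)].
Qed.

Lemma uniq_covered (d : point) (ms : seq move) :
  legal_play ms -> uniq (covered d ms).
Proof.
elim/last_ind: ms => // ms m IH; rewrite legal_play_rcons.
case/andP=> /IH ucov /and5P[dm _ _ _ disj].
rewrite covered_rcons; case: eqP => [def_d | _]; last by rewrite cats0.
rewrite cat_uniq ucov uniq_line_points // andbT.
by apply: disjoint_covered; rewrite -def_d.
Qed.

(** [covered d ms] is free of repetitions and lies inside the list of initial and added crosses, so
    it is no longer than that list. *)
Lemma lines_in_direction (d : point) (ms : seq move) :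
  legal_play ms -> 5 * count (fun m => line_dir m == d) ms <= 36 + size ms.
Proof.
move=> lms; rewrite -size_covered -size_initial_crosses.
rewrite -(size_map new_cross ms) -size_cat.
apply: uniq_leq_size; first exact: uniq_covered.
have /allP cov := covered_has_cross d lms.
move=> p /cov; rewrite mem_cat => /orP.
by case=> [/mem_initial_crosses -> | ->]; rewrite ?orbT.
Qed.

(** The four vectors are pairwise distinct, so each move is counted exactly once. *)
Lemma size_sum_directions (ms : seq move) :
  legal_play ms ->
  size ms = \sum_(d <- directions) count (fun m => line_dir m == d) ms.
Proof.
elim/last_ind: ms => [|ms m IH]; first by rewrite big1.
rewrite legal_play_rcons => /andP[/IH sz /and5P[dm _ _ _ _]].
rewrite size_rcons {}sz !big_cons !big_nil -!cats1 !count_cat /=.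
by move: dm; rewrite !inE => /or4P[] /eqP-> /=; lia.
Qed.

Theorem theorem4 (ms : seq move) (Hms : legal_play ms) : (size ms <= 132)%N.
Proof.
rewrite leqNgt; apply/negP => lt132.
(* Truncation matters: the same count on a whole play of 140 moves allows 35 lines per direction,
   140 in all, and gives no contradiction. *)
have lplay := legal_play_take 133 Hms.
have sz133 : size (take 133 ms) = 133 by rewrite size_takel.
have le33 d : count (fun m => line_dir m == d) (take 133 ms) <= 33.
  by have := lines_in_direction d lplay; rewrite sz133; lia.
have : 133 <= \sum_(d <- directions) 33.
  by rewrite -{1}sz133 (size_sum_directions lplay); apply: leq_sum.
by rewrite !big_cons big_nil.
Qed.
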